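(* Let $X$ be a finite biquandle, $R$ a commutative ring with identity, and $C:X\to R^{\times}$ a map. Let $\gamma:X\times X\to R^{\times}$ be the biquandle bracket defined by setting both of its coefficient maps equal to \[\gamma(x,y)=C(x)\,C(y)^{-1}\,C(x\,\underline{\triangleright}\,y)^{-1}\,C(y\,\overline{\triangleright}\,x).\] Then for any biquandle bracket $\beta$ on $X$ over $R$ defined by maps $A,B:X\times X\to R^{\times}$, the maps \[A'_{x,y}=A_{x,y}\,\gamma(x,y)\quad\text{and}\quad B'_{x,y}=B_{x,y}\,\gamma(x,y)\] define a biquandle bracket $\gamma\beta$ on $X$ over $R$ with $\delta=-A_{x,y}B_{x,y}^{-1}-A_{x,y}^{-1}B_{x,y}$, and $\Phi_X^{\beta}=\Phi_X^{\gamma\beta}$, i.e. $\Phi_X^{\beta}(L)=\Phi_X^{\gamma\beta}(L)$ for every oriented link $L$.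
   Context: \textbf{Biquandle.} A biquandle is a set $X$ with two binary operations $\underline{\triangleright},\overline{\triangleright}:X\times X\to X$ such that for all $x,y,z\in X$: (i) $x\,\underline{\triangleright}\,x=x\,\overline{\triangleright}\,x$; (ii) the maps $\alpha_y,\beta_y:X\to X$ and $S:X\times X\to X\times X$ given by $\alpha_y(x)=x\,\overline{\triangleright}\,y$, $\beta_y(x)=x\,\underline{\triangleright}\,y$, $S(x,y)=(y\,\overline{\triangleright}\,x,\;x\,\underline{\triangleright}\,y)$ are invertible; (iii) the exchange laws hold: \[(x\,\underline{\triangleright}\,y)\,\underline{\triangleright}\,(z\,\underline{\triangleright}\,y)=(x\,\underline{\triangleright}\,z)\,\underline{\triangleright}\,(y\,\overline{\triangleright}\,z),\] \[(x\,\underline{\triangleright}\,y)\,\overline{\triangleright}\,(z\,\underline{\triangleright}\,y)=(x\,\overline{\triangleright}\,z)\,\underline{\triangleright}\,(y\,\overline{\triangleright}\,z),\] \[(x\,\overline{\triangleright}\,y)\,\overline{\triangleright}\,(z\,\overline{\triangleright}\,y)=(x\,\overline{\triangleright}\,z)\,\overline{\triangleright}\,(y\,\underline{\triangleright}\,z).\] \textbf{Biquandle bracket.} Let $X$ be a finite biquandle and $R$ a commutative ring with identity, with group of units $R^\times$. A biquandle bracket on $X$ with values in $R$ (also called an $X$-bracket over $R$) is a pair of maps $A,B:X\times X\to R^{\times}$, written $A_{x,y}=A(x,y)$ and $B_{x,y}=B(x,y)$, together with distinguished elements $\delta\in R$ and $w\in R^\times$ such that: (i) for all $x\in X$, $\delta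 A_{x,x}+B_{x,x}=w$ and $\delta A_{x,x}^{-1}+B_{x,x}^{-1}=w^{-1}$; (ii) for all $x,y\in X$, $\delta=-A_{x,y}B_{x,y}^{-1}-A_{x,y}^{-1}B_{x,y}$; (iii) for all $x,y,z\in X$, writing $a=x\,\underline{\triangleright}\,y$, $b=z\,\overline{\triangleright}\,y$, $c=y\,\overline{\triangleright}\,x$, $d=z\,\overline{\triangleright}\,x$, $e=x\,\underline{\triangleright}\,z$, $f=y\,\underline{\triangleright}\,z$, \[A_{x,y}A_{y,z}A_{a,b}=A_{x,z}A_{c,d}A_{e,f},\] \[A_{x,y}B_{y,z}B_{a,b}=B_{x,z}B_{c,d}A_{e,f},\] \[B_{x,y}A_{y,z}B_{a,b}=B_{x,z}A_{c,d}B_{e,f},\] \[A_{x,y}A_{y,z}B_{a,b}=A_{x,z}B_{c,d}A_{e,f}+A_{x,z}A_{c,d}B_{e,f}+\delta A_{x,z}B_{c,d}B_{e,f}+B_{x,z}B_{c,d}B_{e,f},\] \[B_{x,y}A_{y,z}A_{a,b}+A_{x,y}B_{y,z}A_{a,b}+\delta B_{x,y}B_{y,z}A_{a,b}+B_{x,y}B_{y,z}B_{a,b}=B_{x,z}A_{c,d}A_{e,f}.\] Setting both coefficient maps equal to $\gamma$ gives a biquandle bracket with $\delta=-2$ and $w=-1$. \textbf{Colorings.} A biquandle coloring (or $X$-labeling) of an oriented link diagram $D$ assigns an element of $X$ to each semiarc (edge of the underlying 4-valent graph of $D$) so that at each crossing, drawn with both strands oriented downward, if the left-hand under-semiarc is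 colored $x$ and the left-hand over-semiarc is colored $y$, then the right-hand under-semiarc is colored $x\,\underline{\triangleright}\,y$ and the right-hand over-semiarc is colored $y\,\overline{\triangleright}\,x$. (So at a positive crossing the incoming under-semiarc is $x$, the outgoing under-semiarc is $x\,\underline{\triangleright}\,y$, the incoming over-semiarc is $y\,\overline{\triangleright}\,x$ and the outgoing over-semiarc is $y$; at a negative crossing the incoming under-semiarc is $x\,\underline{\triangleright}\,y$, the outgoing under-semiarc is $x$, the incoming over-semiarc is $y$ and the outgoing over-semiarc is $y\,\overline{\triangleright}\,x$.) The pair $(x,y)$ is the pair of colors attached to the crossing. Colorings of a diagram of $L$ correspond to biquandle homomorphisms $f\in\mathrm{Hom}(\mathcal{B}(L),X)$ from the fundamental biquandle of $L$. \textbf{The invariant.} Given an $X$-bracket $\beta$ and an $X$-coloring $f$ of an oriented link diagram $D$ with $p$ positive and $n$ negative crossings, a state is a choice, at every crossing, of the oriented smoothing (the one consistent with the orientation) or the unoriented smoothing (the other one). At a positive crossing with colors $(x,y)$ the oriented smoothing has coefficient $A_{x,y}$ and the unoriented one $B_{x,y}$; at a negative crossing the coefficients are $A_{x,y}^{-1}$ and $B_{x,y}^{-1}$ respectively. Define \[\beta(f)=w^{n-p}\sum_{\text{states}}\Big(\prod_{\text{crossings}}\text{smoothing coefficient}\Big)\delta^{k},\] where $k$ is the number of circles in the state. This is unchanged by $X$-colored Reidemeister moves. For an oriented link $L$, the biquandle bracket multiset invariant is the multiset $\Phi_X^{\beta,M}(L)=\{\beta(f)\mid f\in\mathrm{Hom}(\mathcal{B}(L),X)\}$,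 and the biquandle bracket polynomial is $\Phi_X^{\beta}(L)=\sum_{f}u^{\beta(f)}$, a formal sum in which $u$ is a formal variable with exponents in $R$; it encodes the same information as the multiset. *)

(* Defs.v *)
From HB Require Import structures.
From mathcomp Require Import all_boot all_algebra.
From mathcomp Require Import freeg.

Set Implicit Arguments.
Unset Strict Implicit.
Unset Printing Implicit Defensive.

Import GRing.Theory.
Local Open Scope ring_scope.

Reserved Notation "x \ut y" (at level 40, left associativity).
Reserved Notation "x \ot y" (at level 40, left associativity).

(** * The group of units *)

(* GRing.unit lives on unitRingType, which excludes the zero ring and asks for
   decidable invertibility.  In order to cover every commutative ring with
   identity, a unit is an element paired with its (necessarily unique)
   inverse. *)
Record units (R : comPzRingType) :=
  Units { unit_pair : R * R; _ : unit_pair.1 * unit_pair.2 == 1 }.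

HB.instance Definition _ (R : comPzRingType) := [isSub for @unit_pair R].
HB.instance Definition _ (R : comPzRingType) := [Choice of units R by <:].

Definition uval (R : comPzRingType) (u : units R) : R := (unit_pair u).1.

Section UnitsGroup.
Variable R : comPzRingType.
Implicit Types u v t : units R.

Fact units_oneP : ((1, 1) : R * R).1 * ((1, 1) : R * R).2 == 1.
Proof. by rewrite mulr1. Qed.
Definition units_one : units R := Units units_oneP.

Fact units_invP u : ((unit_pair u).2, (unit_pair u).1).1 *
  ((unit_pair u).2, (unit_pair u).1).2 == 1.
Proof. by case: u => [[a b] ab1]; rewrite mulrC. Qed.
Definition units_inv u : units R := Units (units_invP u).

Fact units_mulP u v :
  ((unit_pair u).1 * (unit_pair v).1, (unit_pair u).2 * (unit_pair v).2).1 *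
  ((unit_pair u).1 * (unit_pair v).1, (unit_pair u).2 * (unit_pair v).2).2 == 1.
Proof.
case: u v => [[a b] /= /eqP ab1] [[c d] /= /eqP cd1].
by rewrite mulrACA ab1 cd1 mulr1.
Qed.
Definition units_mul u v : units R := Units (units_mulP u v).

Fact units_mulA : associative units_mul.
Proof. by move=> u v t; apply/val_inj; rewrite /= !mulrA. Qed.
Fact units_mul1 : left_id units_one units_mul.
Proof. by move=> [[a b] p]; apply/val_inj; rewrite /= !mul1r. Qed.
Fact units_mulr1 : right_id units_one units_mul.
Proof. by move=> [[a b] p]; apply/val_inj; rewrite /= !mulr1. Qed.
Fact units_mulV : left_inverse units_one units_inv units_mul.
Proof.
case=> [[a b] ab1]; apply/val_inj; rewrite /= ![b * a]mulrC.
by move/eqP: ab1 => /= ->.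
Qed.
Fact units_mulrV : right_inverse units_one units_inv units_mul.
Proof.
case=> [[a b] ab1]; apply/val_inj; rewrite /= ![b * a]mulrC.
by move/eqP: ab1 => /= ->.
Qed.

HB.instance Definition _ := isGroup.Build (units R)
  units_mulA units_mul1 units_mulr1 units_mulV units_mulrV.

Fact units_N1P : ((-1, -1) : R * R).1 * ((-1, -1) : R * R).2 == 1.
Proof. by rewrite mulrNN mulr1. Qed.
Definition units_N1 : units R := Units units_N1P.
End UnitsGroup.

(** * Biquandles *)

(* [x \ut y] is x under-triangle y and [x \ot y] is x over-triangle y. *)
HB.mixin Record isBiquandle X := {
  ut : X -> X -> X;
  ot : X -> X -> X;
  biq_diag : forall x, ut x x = ot x x;
  biq_alpha : forall y, bijective (fun x => ot x y);
  biq_beta : forall y, bijective (fun x => ut x y);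
  biq_S : bijective (fun p : X * X => (ot p.2 p.1, ut p.1 p.2));
  biq_exchange_uu : forall x y z,
    ut (ut x y) (ut z y) = ut (ut x z) (ot y z);
  biq_exchange_uo : forall x y z,
    ot (ut x y) (ut z y) = ut (ot x z) (ot y z);
  biq_exchange_oo : forall x y z,
    ot (ot x y) (ot z y) = ot (ot x z) (ut y z)
}.

#[short(type="biquandleType")]
HB.structure Definition Biquandle := {X of isBiquandle X}.

#[short(type="finBiquandleType")]
HB.structure Definition FinBiquandle := {X of isBiquandle X & Finite X}.

Notation "x \ut y" := (ut x y) : ring_scope.
Notation "x \ot y" := (ot x y) : ring_scope.

(** * Biquandle brackets *)

(* Fields: the maps A and B, and the elements delta and w. *)
Record bracket_data (X : Type) (R : comPzRingType) := BracketData {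
  brA : X -> X -> units R;
  brB : X -> X -> units R;
  brdelta : R;
  brw : units R
}.

Record is_bracket (X : finBiquandleType) (R : comPzRingType)
    (beta : bracket_data X R) : Prop := {
  bracket_w :
    let A x y := uval (brA beta x y) in
    let B x y := uval (brB beta x y) in
    let Ai x y := uval (brA beta x y)^-1%g in
    let Bi x y := uval (brB beta x y)^-1%g in
    forall x,
      brdelta beta * A x x + B x x = uval (brw beta) /\
      brdelta beta * Ai x x + Bi x x = uval (brw beta)^-1%g;
  bracket_delta :
    let A x y := uval (brA beta x y) in
    let B x y := uval (brB beta x y) in
    let Ai x y := uval (brA beta x y)^-1%g in
    let Bi x y := uval (brB beta x y)^-1%g in
    forall x y, brdelta beta = - (A x y * Bi x y) - Ai x y * B x y;
  bracket_R3 :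
    let A x y := uval (brA beta x y) in
    let B x y := uval (brB beta x y) in
    forall x y z,
    let a := x \ut y in let b := z \ot y in
    let c := y \ot x in let d := z \ot x in
    let e := x \ut z in let f := y \ut z in
    [/\ A x y * A y z * A a b = A x z * A c d * A e f,
        A x y * B y z * B a b = B x z * B c d * A e f,
        B x y * A y z * B a b = B x z * A c d * B e f,
        A x y * A y z * B a b
        = A x z * B c d * A e f + A x z * A c d * B e f
          + brdelta beta * A x z * B c d * B e f + B x z * B c d * B e f &
        B x y * A y z * A a b + A x y * B y z * A a b
          + brdelta beta * B x y * B y z * A a b + B x y * B y z * B a b
        = B x z * A c d * A e f]
}.

Definition gamma_map (X : finBiquandleType) (R : comPzRingType)
    (C : X -> units R) (x y : X) : units R :=
  (C x * (C y)^-1 * (C (x \ut y))^-1 * C (y \ot x))%g.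

Definition gamma_bracket (X : finBiquandleType) (R : comPzRingType)
    (C : X -> units R) : bracket_data X R :=
  {| brA := gamma_map C; brB := gamma_map C; brdelta := - 2; brw := units_N1 R |}.

Definition gamma_times (X : finBiquandleType) (R : comPzRingType)
    (C : X -> units R) (beta : bracket_data X R) : bracket_data X R :=
  {| brA := fun x y => (brA beta x y * gamma_map C x y)%g;
     brB := fun x y => (brB beta x y * gamma_map C x y)%g;
     brdelta := brdelta beta;
     brw := brw beta |}.

(** * Oriented link diagrams *)

Definition ncomponents (T : finType) (e : rel T) : nat :=
  n_comp (fun x y => e x y || e y x) T.

(* A diagram is given by its crossings, its semiarcs and their incidence.
   Every crossing is drawn with both strands oriented downward, so that its
   four corners are
          (false, false) top left        (false, true) top right
          (true,  false) bottom left     (true,  true) bottom right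
   where the first component tells whether the strand leaves the crossing and
   the second one whether the corner is on the right.  At a positive crossing
   the under-strand runs from top left to bottom right and the over-strand from
   top right to bottom left; at a negative crossing it is the other way round. *)
Definition corner : finType := (bool * bool)%type.
Definition top_left : corner := (false, false).
Definition top_right : corner := (false, true).
Definition bot_left : corner := (true, false).
Definition bot_right : corner := (true, true).

(* Counterclockwise successor. *)
Definition ccw (p : corner) : corner :=
  match p with
  | (false, false) => bot_left
  | (true, false) => bot_right
  | (true, true) => top_right
  | (false, true) => top_left
  end.

(* [semiarc_at (v, p)] is the semiarc that meets the crossing v at its corner p.
   A semiarc ends at most once and starts at most once at a crossing, and it
   ends at one iff it starts at one; the semiarcs that meet no crossing are the
   closed components without crossings.  A corner (v, p) is also a dart
   (half-edge) of the underlying 4-valent graph.  The faces are the cycles of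
   the map sending a dart to the counterclockwise successor of the opposite
   half of its edge, and planarity is Euler's formula V - E + F = 2 K, with
   E = 2 V and K the number of connected components of the graph (the faces
   being counted separately in each of these). *)
Record link_diagram := LinkDiagram {
  crossing : finType;
  semiarc : finType;
  positive : pred crossing;
  semiarc_at : crossing * corner -> semiarc;
  diagram_in_inj : forall v v' s s',
    semiarc_at (v, (false, s)) = semiarc_at (v', (false, s')) ->
    (v, s) = (v', s');
  diagram_out_inj : forall v v' s s',
    semiarc_at (v, (true, s)) = semiarc_at (v', (true, s')) ->
    (v, s) = (v', s');
  diagram_in_out : forall a,
    (exists v s, semiarc_at (v, (false, s)) = a) <->
    (exists v s, semiarc_at (v, (true, s)) = a);
  diagram_planar :
    let next_dart (d d' : crossing * corner) :=
      [exists o : crossing * corner,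
        [&& o != d, semiarc_at o == semiarc_at d & d' == (o.1, ccw o.2)]] in
    let adjacent (v v' : crossing) :=
      [exists p : corner, exists p' : corner,
        semiarc_at (v, p) == semiarc_at (v', p')] in
    (#|crossing| + ncomponents next_dart
     = 2 * #|crossing| + 2 * ncomponents adjacent)%N
}.

Section Invariant.
Variables (X : finBiquandleType) (R : comPzRingType).
Variable D : link_diagram.

Definition under_left (v : crossing D) : semiarc D :=
  semiarc_at (v, if positive v then top_left else bot_left).
Definition under_right (v : crossing D) : semiarc D :=
  semiarc_at (v, if positive v then bot_right else top_right).
Definition over_left (v : crossing D) : semiarc D :=
  semiarc_at (v, if positive v then bot_left else top_left).
Definition over_right (v : crossing D) : semiarc D :=
  semiarc_at (v, if positive v then top_right else bot_right).

Definition is_coloring (f : {ffun semiarc D -> X}) : bool :=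
  [forall v,
    (f (under_right v) == f (under_left v) \ut f (over_left v)) &&
    (f (over_right v) == f (over_left v) \ot f (under_left v))].

(* A state maps a crossing to true for the oriented smoothing, which joins the
   two corners of each side, and to false for the unoriented one, which joins
   the two top corners and the two bottom corners.  The circles of a state are
   the classes of semiarcs under the resulting identifications. *)
Definition state : finType := {ffun crossing D -> bool}.

Definition joined (s : state) (a b : semiarc D) : bool :=
  [exists v,
    let is_ab p q := (a == semiarc_at (v, p)) && (b == semiarc_at (v, q)) in
    if s v then is_ab top_left bot_left || is_ab top_right bot_right
    else is_ab top_left top_right || is_ab bot_left bot_right].

Definition circles (s : state) : nat := ncomponents (joined s).

Variable beta : bracket_data X R.

Definition smoothing_coef (f : {ffun semiarc D -> X}) (s : state)
    (v : crossing D) : units R :=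
  let x := f (under_left v) in
  let y := f (over_left v) in
  let c := if s v then brA beta x y else brB beta x y in
  if positive v then c else c^-1%g.

(* The factor w^(n - p) is written w^n * w^(-p). *)
Definition bracket_value (f : {ffun semiarc D -> X}) : R :=
  let p := #|[pred v : crossing D | positive v]| in
  let n := #|[pred v : crossing D | ~~ positive v]| in
  uval (brw beta ^+ n * brw beta ^- p)%g *
  \sum_(s : state) (\prod_(v : crossing D) uval (smoothing_coef f s v))
                   * brdelta beta ^+ circles s.

(* The formal sum of the u^(beta(f)), as an element of the free abelian group
   on R: the generator << r >> stands for u^r. *)
Definition bracket_polynomial : {freeg R / int} :=
  \sum_(f : {ffun semiarc D -> X} | is_coloring f) << bracket_value f >>.

End Invariant.

(* Main.v *)
(* Twisting both coefficient maps by gamma multiplies every coefficient product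
   occurring in a bracket axiom, except those in the definitions of delta and w,
   by gamma(x,y) gamma(y,z) gamma(a,b) = gamma(x,z) gamma(c,d) gamma(e,f); after
   cancellation, this identity is exactly the exchange laws.  In the state sum,
   both smoothings of a crossing are multiplied by the C-weights of its two
   incoming semiarcs over the C-weights of its two outgoing ones, whatever its
   sign.  Every semiarc meeting a crossing comes in exactly once and goes out
   exactly once, so these factors cancel over the whole diagram. *)
Require Import Defs.
From HB Require Import structures.
From mathcomp Require Import all_boot all_algebra.
From mathcomp Require Import freeg ring.
Import GRing.Theory.
Local Open Scope ring_scope.

Lemma uvalM {R : comPzRingType} (u v : units R) :
  uval (u * v)%g = uval u * uval v.
Proof. by []. Qed.

Lemma uval_mulV {R : comPzRingType} (u : units R) : uval u * uval u^-1%g = 1.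
Proof. by rewrite -uvalM mulgV. Qed.

Lemma gamma_map_diag (X : finBiquandleType) (R : comPzRingType)
    (C : X -> units R) (x : X) : gamma_map C x x = 1%g.
Proof. by rewrite /gamma_map mulgV mul1g biq_diag mulVg. Qed.

Lemma gamma_map_cocycle (X : finBiquandleType) (R : comPzRingType)
    (C : X -> units R) (x y z : X) :
  let g x y := uval (gamma_map C x y) in
  g x y * g y z * g (x \ut y) (z \ot y)
  = g x z * g (y \ot x) (z \ot x) * g (x \ut z) (y \ut z).
Proof.
rewrite /gamma_map !uvalM -(biq_exchange_uu x z y) -(biq_exchange_oo z x y).
rewrite (biq_exchange_uo y z x).
have C1 t := uval_mulV (C t).
(* [K] collects the weights of the six outer ends of the Reidemeister III tangle, whose colors agree
   on both sides by the exchange laws; the weights of the three inner semiarcs cancel on each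
   side. *)
pose K := uval (C x) * uval (C z)^-1%g * uval (C (y \ut z))^-1%g
  * uval (C (y \ot x)) * uval (C ((x \ut z) \ut (y \ut z)))^-1%g
  * uval (C ((z \ot x) \ot (y \ot x))).
transitivity K; rewrite /K.
  ring: (C1 y) (C1 (x \ut y)) (C1 (z \ot y)).
by ring: (C1 (z \ot x)) (C1 (x \ut z)) (C1 ((y \ot x) \ut (z \ot x))).
Qed.

(** Abstract in [g] and [beta'] so as to serve twice: for the twist of a given bracket, and for
    [gamma_bracket] as a twist of the constant bracket. *)
Lemma is_bracket_twist (X : finBiquandleType) (R : comPzRingType)
    (beta beta' : bracket_data X R) (g : X -> X -> units R) :
  (forall x, g x x = 1%g) ->
  (forall x y z,
    uval (g x y) * uval (g y z) * uval (g (x \ut y) (z \ot y))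
    = uval (g x z) * uval (g (y \ot x) (z \ot x)) * uval (g (x \ut z) (y \ut z))) ->
  (forall x y, brA beta' x y = (brA beta x y * g x y)%g) ->
  (forall x y, brB beta' x y = (brB beta x y * g x y)%g) ->
  brdelta beta' = brdelta beta -> brw beta' = brw beta ->
  is_bracket beta -> is_bracket beta'.
Proof.
move=> g1 gC eqA eqB eqd eqw [/= bw bd bR3]; split=> /=.
- by move=> x; rewrite eqA eqB g1 !mulg1 eqd eqw.
- move=> x y; rewrite eqA eqB eqd (bd x y) !invgM !uvalM.
  by ring: (uval_mulV (g x y)).
move=> x y z; rewrite !eqA !eqB eqd !uvalM.
(* All monomials on one side of an identity gain the same triple product of [g], so sums factor as
   well; [gC] equates the two triple products. *)
have twist P Q L L' : P = Q ->
    L = P * (uval (g x y) * uval (g y z) * uval (g (x \ut y) (z \ot y))) ->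
    L' = Q * (uval (g x z) * uval (g (y \ot x) (z \ot x))
              * uval (g (x \ut z) (y \ut z))) -> L = L'.
  by move=> -> -> ->; rewrite gC.
by have [e1 e2 e3 e4 e5] := bR3 x y z; split;
  [apply: twist e1 _ _ | apply: twist e2 _ _ | apply: twist e3 _ _
  |apply: twist e4 _ _ | apply: twist e5 _ _]; ring.
Qed.

(** The bracket whose twist is [gamma_bracket]: with A = B = 1 the axioms force delta = -1 - 1 and w
    = delta + 1. *)
Lemma is_bracket_const (X : finBiquandleType) (R : comPzRingType) :
  is_bracket (BracketData (fun _ _ : X => 1%g) (fun _ _ => 1%g) (- 2) (units_N1 R)).
Proof.
have one1 : uval (1%g : units R) = 1 by [].
have oneV : uval (1^-1)%g = 1 :> R by [].
split=> /= [x | x y | x y z]; rewrite one1 ?oneV.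
- have N1 : uval (units_N1 R) = -1 by [].
  have N1V : uval (units_N1 R)^-1%g = -1 by [].
  by rewrite N1 N1V; split; ring.
- by ring.
- by split; ring.
Qed.

(** Both families list the same image without repetition, so the two lists are permutations of each
    other. *)
Lemma big_inj_codom (T : Type) (idx : T) (op : Monoid.com_law idx)
    (I J : finType) (K : eqType) (F : I -> K) (G : J -> K) (h : K -> T) :
  injective F -> injective G -> codom F =i codom G ->
  \big[op/idx]_i h (F i) = \big[op/idx]_j h (G j).
Proof.
move=> injF injG FG.
rewrite -(big_image op idx F predT h) -(big_image op idx G predT h).
by apply: perm_big; apply: uniq_perm => //; rewrite map_inj_uniq ?enum_uniq.
Qed.

Lemma prod_ends_eq (R : comPzRingType) (D : link_diagram) (h : semiarc D -> R) :
  \prod_v \prod_(r : bool) h (semiarc_at (v, (false, r)))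
  = \prod_v \prod_(r : bool) h (semiarc_at (v, (true, r))).
Proof.
rewrite !pair_big /=.
apply: (big_inj_codom _ _ _ _ _ _ (fun p => semiarc_at (p.1, (false, p.2)))
                      (fun p => semiarc_at (p.1, (true, p.2)))).
- by move=> [v r] [v' r'] /diagram_in_inj.
- by move=> [v r] [v' r'] /diagram_out_inj.
move=> a; apply/codomP/codomP => -[[v r] /= ->].
  have [|v' [r' <-]] := (diagram_in_out (semiarc_at (v, (false, r)))).1.
    by exists v, r.
  by exists (v', r').
have [|v' [r' <-]] := (diagram_in_out (semiarc_at (v, (true, r)))).2.
  by exists v, r.
by exists (v', r').
Qed.

Lemma smoothing_coef_gamma (X : finBiquandleType) (R : comPzRingType)
    (C : X -> units R) (beta : bracket_data X R) (D : link_diagram)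
    (f : {ffun semiarc D -> X}) (s : state D) (v : crossing D) :
  is_coloring f ->
  uval (smoothing_coef (gamma_times C beta) f s v)
  = uval (smoothing_coef beta f s v)
    * ((\prod_(r : bool) uval (C (f (semiarc_at (v, (false, r))))))
       * \prod_(r : bool) uval (C (f (semiarc_at (v, (true, r)))))^-1%g).
Proof.
move=> /forallP/(_ v)/andP[/eqP fu /eqP fo].
rewrite !big_bool /smoothing_coef /= /gamma_map -fu -fo.
rewrite /under_left /over_left /under_right /over_right.
(* A negative crossing inverts the coefficient, but there the incoming semiarcs are [over_left] and
   [under_right], whose weights stand inverted in [gamma_map]. *)
by case: (s v) (positive v) => -[] /=; rewrite ?invgM ?invgK !uvalM; ring.
Qed.

Lemma bracket_value_gamma (X : finBiquandleType) (R : comPzRingType)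
    (C : X -> units R) (beta : bracket_data X R) (D : link_diagram)
    (f : {ffun semiarc D -> X}) :
  is_coloring f ->
  bracket_value (gamma_times C beta) f = bracket_value beta f.
Proof.
move=> col_f; congr (_ * _); apply: eq_bigr => s _; congr (_ * _).
rewrite (eq_bigr _ (fun v _ => smoothing_coef_gamma _ _ C beta _ _ s v col_f)).
(* Over the whole diagram the incoming weights are traded for the outgoing ones, which then meet
   their inverses crossing by crossing. *)
rewrite 2!big_split /= (prod_ends_eq _ _ (fun a => uval (C (f a)))) -big_split.
rewrite [X in _ * X]big1 ?mulr1 // => v _.
by rewrite -big_split big1 //= => r _; apply: uval_mulV.
Qed.

Theorem proposition2 (X : finBiquandleType) (R : comPzRingType)
    (C : X -> units R) :
  is_bracket (gamma_bracket C) /\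
  forall beta : bracket_data X R, is_bracket beta ->
    [/\ is_bracket (gamma_times C beta),
        forall x y : X,
          brdelta (gamma_times C beta)
          = - (uval (brA beta x y) * uval (brB beta x y)^-1%g)
            - uval (brA beta x y)^-1%g * uval (brB beta x y) &
        forall L : link_diagram,
          bracket_polynomial L beta
          = bracket_polynomial L (gamma_times C beta)].
Proof.
have g1 := gamma_map_diag X R C; have gC := gamma_map_cocycle X R C.
split=> [|beta br_beta].
  apply: is_bracket_twist g1 gC _ _ _ _ (is_bracket_const X R) => //= x y;
    by rewrite mul1g.
split=> [|x y|L]; first exact: is_bracket_twist g1 gC _ _ _ _ br_beta.
  exact: bracket_delta br_beta x y.
by apply: eq_bigr => f col_f; rewrite bracket_value_gamma.
Qed.
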